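(* Let $\varepsilon\in(0,1/24)$ and let $p=p(n)$ satisfy $n^{5/8+\varepsilon}\le np\ll n^{2/3}$. Let $k=\lceil 15p^{-2}(n^{-1}\log n)^{1/2}\rceil$ and $k_*=\frac12\sqrt{\frac{\log(1/(np^3))}{2np^3}}$, and let $(Z_\ell)_{\ell=1}^{2k}$ be independent random variables with $Z_\ell\in\mathrm{Bin}(z_\ell,p)$, where $$z_\ell=n-(\ell-1)np+\tfrac12(\ell-1)(\ell-2)np^2 .$$ Let $Z^{(1)}_*=\max\{Z_\ell:1\le\ell\le k_*\}$ and $Z^{(2)}_*=\max\{Z_\ell:\ell\in[k_*],\,Z_\ell<Z^{(1)}_*\}$. Let $(\varepsilon_n)_{n\ge1}$ be a sequence of positive real numbers converging to $0$ such that $\varepsilon_n\ge(\log(np))^{-1/2}$ for all sufficiently large $n$ and such that $$M_n=np+\sqrt{\big(1-\tfrac{\varepsilon_n}{2}\big)np\log(1/(np^3))}$$ is a.a.s. smaller than $Z^{(1)}_*$, and let $\gamma_n=(np)^{1/2-\varepsilon_n}$. Then $$\mathbb P\big(Z_*^{(2)}\le Z_*^{(1)}-2\gamma_n\big)=1-o(1)\qquad\text{as }n\to\infty.$$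
   Context: $[m]=\{1,\dots,m\}$; $f\ll g$ means $f=o(g)$ as $n\to\infty$; a.a.s. means with probability tending to $1$ as $n\to\infty$; $Z\in\mathrm{Bin}(z,p)$ means that $Z$ is binomially distributed with parameters $z$ and $p$. Quantities such as $z_\ell$, $k_*$, $M_n$ and $\gamma_n$ that must be integers are understood to be rounded up or down where needed. (In the paper, a sequence $(\varepsilon_n)$ with the stated properties is shown to exist and is fixed before the lemma.) *)

(* Defs.v *)
From HB Require Import structures.
From mathcomp Require Import all_boot all_order all_algebra.
From mathcomp Require Import all_classical all_reals all_analysis.

Set Implicit Arguments.
Unset Strict Implicit.
Unset Printing Implicit Defensive.

Import Order.TTheory GRing.Theory Num.Theory.
Import numFieldNormedType.Exports.

Local Open Scope classical_set_scope.
Local Open Scope ring_scope.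

(* "m is x rounded up or down". A hypothesis [is_rounding x m] leaves the choice
   of direction open, so it may vary with n (and with l, for z_l). It forces
   x > -1; as some of the expressions below can be negative for small n, it
   should only be assumed for large n. *)
Definition is_rounding {R : realType} (x : R) (m : nat) : Prop :=
  m%:Z = Num.floor x \/ m%:Z = Num.ceil x.

Section parameters.
Context {R : realType}.
Implicit Types (p : nat -> R) (eps : nat -> R) (n l : nat).

(* The argument of the ceiling is nonnegative, so `|_|%N is only a cast. *)
Definition kbound p n : nat :=
  `|Num.ceil (15 * p n ^- 2 * Num.sqrt (n%:R^-1 * ln n%:R))|%N.

Definition kstar p n : R :=
  2^-1 * Num.sqrt (ln (1 / (n%:R * p n ^+ 3)) / (2 * (n%:R * p n ^+ 3))).

(* l - 1 and l - 2 are subtractions in R, not truncated ones. *)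
Definition zpar p n l : R :=
  n%:R - (l%:R - 1) * (n%:R * p n)
  + 2^-1 * ((l%:R - 1) * (l%:R - 2)) * (n%:R * p n ^+ 2).

Definition Mpar p eps n : R :=
  n%:R * p n
  + Num.sqrt ((1 - eps n / 2) * (n%:R * p n) * ln (1 / (n%:R * p n ^+ 3))).

Definition gammapar p eps n : R := (n%:R * p n) `^ (2^-1 - eps n).

End parameters.

(* Mutual independence of the random variables X i, i in I: the product rule
   for every finite subfamily, listed without repetition by s. *)
Definition mutually_independent d d' (T : measurableType d)
    (T' : measurableType d') (R : realType) (P : probability T R)
    (I : set nat) (X : nat -> {RV P >-> T'}) : Prop :=
  forall (s : seq nat) (A : nat -> set T'),
    uniq s -> (forall i, i \in s -> I i) ->
    (forall i, i \in s -> measurable (A i)) ->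
    P (\bigcap_(i in [set` s]) (X i @^-1` A i)) =
    (\prod_(i <- s) P (X i @^-1` A i))%E.

(* The events E n may live on different probability spaces. *)
Definition aas (R : realType) (d : nat -> measure_display)
    (T : forall n, measurableType (d n)) (P : forall n, probability (T n) R)
    (E : forall n, set (T n)) : Prop :=
  P n (E n) @[n --> \oo] --> (1 : \bar R)%E.

Definition Zmax1 (T : Type) (X : nat -> T -> nat) (k : nat) (w : T) : nat :=
  (\max_(1 <= l < k.+1) X l w)%N.

(* The maximum of the empty set is 0 here: this matters only when
   X 1 w = ... = X k w. *)
Definition Zmax2 (T : Type) (X : nat -> T -> nat) (k : nat) (w : T) : nat :=
  (\max_(1 <= l < k.+1 | X l w < Zmax1 X k w) X l w)%N.

(* Main.v *)
(* If the two largest distinct values are closer than 2 gamma while the largest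
   exceeds M, then for some l <> l' and 0 <= i < 2 gamma one has Z_l > M and
   Z_l' = Z_l - i. By independence the expected number of such configurations is
   at most k^2 * P(Z > M) * 2 gamma * sup_{j > M - 2 gamma} P(Z = j). With
   N = np and L = ln(1/(np^3)), Chernoff's bound gives
   P(Z > M) = O(exp(-(1 - eps/2) L / 2)), and since the pmf decreases beyond the
   mean, averaging it over a window of length r = N^((1 - eps)/2) gives the same
   bound divided by r for P(Z = j). As k^2 = O(L exp L), gamma / r is about
   N^(-eps/2) and L <= ln N / 5, the product is
   O(ln N * N^(-2 eps / 5)), which tends to 0 because eps >= (ln N)^(-1/2). *)

Require Import Defs.
From HB Require Import structures.
From mathcomp Require Import all_boot all_order all_algebra.
From mathcomp Require Import all_classical all_reals all_analysis.
From mathcomp Require Import ring lra zify.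

Set Implicit Arguments.
Unset Strict Implicit.
Unset Printing Implicit Defensive.

Import Order.TTheory GRing.Theory Num.Theory.
Import numFieldNormedType.Exports.

Local Open Scope classical_set_scope.
Local Open Scope ring_scope.

(** * Exponential estimates for the binomial distribution *)

Lemma expR_le_cubic (R : realType) (x : R) : 0 <= x <= 1 ->
  expR x <= 1 + x + x ^+ 2 / 2 + x ^+ 3.
Proof.
move=> /andP[x0 x1].
(* This quotient is 1 at 0 and has derivative exp(-u) u^2 (5/2 - u), which is nonnegative on
   [0, 1]. *)
pose f := fun u : R => expR (- u) * (1 + u + u ^+ 2 / 2 + u ^+ 3).
have df u : is_derive u (1 : R) f (expR (- u) * (5 / 2 * u ^+ 2 - u ^+ 3)).
  apply: is_derive_eq; rewrite /GRing.scale/= ?expr1 ?expr2. by field.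
suff : f 0 <= f x.
  rewrite /f oppr0 expR0 !expr0n/= mul0r !addr0 mulr1 expRN.
  by rewrite mulrC ler_pdivlMr ?expR_gt0// mul1r.
apply: (@ger0_derive1_le _ f 0 1 _ _ true false).
- by move=> v _; case: (df v).
- move=> v; rewrite in_itv/= => /andP[u0 u1].
  have [_ ] := df v; rewrite derive1E => ->.
  rewrite mulr_ge0 ?expR_ge0// subr_ge0 exprS.
  by apply: ler_wpM2r; [exact: exprn_ge0 (ltW u0)|lra].
- by apply: derivable_within_continuous => u _; case: (df u).
- by rewrite in_itv/= lexx ler01.
- by rewrite in_itv/= x0 x1.
- exact: x0.
Qed.

Section binomial_tail.
Context {R : realType}.
Implicit Types (p lambda : R) (z n j a r : nat).

Lemma binomial_mgf z p lambda :
  \sum_(j < z.+1) binomial_pmf z p j * expR (lambda * j%:R) =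
  (1 + p * (expR lambda - 1)) ^+ z.
Proof.
have -> : 1 + p * (expR lambda - 1) = (1 - p) + p * expR lambda by ring.
rewrite exprDn; apply: eq_bigr => j _.
rewrite /binomial_pmf mulrnAl; congr (_ *+ _).
by rewrite exprMn [lambda * _]mulrC expRM_natl mulrA; congr (_ * _); rewrite mulrC.
Qed.

(** By 1 + q <= exp q. Passing from z to n makes the bound uniform over all the [Z_l], whose
    parameters are at most n. *)
Lemma binomial_mgf_le z n p lambda : 0 <= p <= 1 -> 0 <= lambda ->
  (z <= n)%N ->
  \sum_(j < z.+1) binomial_pmf z p j * expR (lambda * j%:R) <=
  expR (n%:R * p * (expR lambda - 1)).
Proof.
move=> /andP[p0 p1] l0 zn; rewrite binomial_mgf.
have q0 : 0 <= p * (expR lambda - 1).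
  by rewrite mulr_ge0// subr_ge0 -expR0 ler_expR.
rewrite -mulrA expRM_natl; apply: (@le_trans _ _ (expR (p * (expR lambda - 1)) ^+ z)).
  by rewrite lerXn2r ?nnegrE ?expR_ge0 ?expR_ge1Dx// addr_ge0.
by rewrite ler_weXn2l// -[leLHS]expR0 ler_expR.
Qed.

Lemma binomial_pmf_small z p j : (z < j)%N -> binomial_pmf z p j = 0.
Proof. by move=> zj; rewrite /binomial_pmf bin_small. Qed.

(** Chernoff's method: the weight exp(lambda (j - a)) is at least 1 on the range of summation.
    Leaving b free covers both whole tails and short windows. *)
Lemma binomial_partial_sum_le z n p lambda a b : 0 <= p <= 1 -> 0 <= lambda ->
  (z <= n)%N ->
  \sum_(a <= j < b) binomial_pmf z p j <=
  expR (n%:R * p * (expR lambda - 1) - lambda * a%:R).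
Proof.
move=> p01 l0 zn; rewrite expRD expRN ler_pdivlMr ?expR_gt0//.
apply: le_trans (binomial_mgf_le p01 l0 zn).
have F0 j : 0 <= binomial_pmf z p j * expR (lambda * j%:R).
  by rewrite mulr_ge0 ?binomial_pmf_ge0 ?expR_ge0.
apply: (@le_trans _ _ (\sum_(a <= j < b) binomial_pmf z p j * expR (lambda * j%:R))).
  rewrite mulr_suml !big_nat; apply: ler_sum => j /andP[aj _].
  by rewrite ler_wpM2l ?binomial_pmf_ge0// ler_expR ler_wpM2l// ler_nat.
rewrite -(big_mkord xpredT (fun j => binomial_pmf z p j * expR (lambda * j%:R))).
(* As b may lie on either side of z + 1, both sums are compared with one up to the larger of the
   two; the terms beyond z vanish. *)
have bz : (b <= maxn b z.+1)%N by exact: leq_maxl.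
have zz : (z.+1 <= maxn b z.+1)%N by exact: leq_maxr.
apply: (@le_trans _ _ (\sum_(0 <= j < maxn b z.+1) binomial_pmf z p j * expR (lambda * j%:R))).
  have [ab|/ltnW ba] := leqP a b; last by rewrite big_geq// sumr_ge0.
  rewrite (@big_cat_nat _ _ _ b 0)//= (@big_cat_nat _ _ _ a 0 b)//=.
  by rewrite -addrA addrCA lerDl addr_ge0 ?sumr_ge0.
rewrite [leLHS](@big_cat_nat _ _ _ z.+1 0)//= gerDl.
rewrite big_nat big1// => j.
by move=> /andP[zj _]; rewrite binomial_pmf_small// mul0r.
Qed.

(** The ratio of consecutive terms is (z - j) p / ((j + 1) (1 - p)), at most 1 once j >= zp. It is
    used cross-multiplied, as 1 - p may be 0. *)
Lemma binomial_pmf_decr z n p j : 0 <= p <= 1 -> (z <= n)%N ->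
  n%:R * p <= j%:R -> binomial_pmf z p j.+1 <= binomial_pmf z p j.
Proof.
move=> p01 zn npj; have [p0 p1] := andP p01.
have [zj|jz] := leqP z j; first by rewrite binomial_pmf_small// binomial_pmf_ge0.
have pmfE i : binomial_pmf z p i = p ^+ i * (1 - p) ^+ (z - i) * 'C(z, i)%:R.
  by rewrite mulr_natr.
have binE : 'C(z, j.+1)%:R * j.+1%:R = (z - j)%:R * 'C(z, j)%:R :> R.
  by rewrite -!natrM [(_ * j.+1)%N]mulnC mul_bin_left.
rewrite -(@ler_pM2r _ j.+1%:R)// !pmfE.
have -> : (z - j = (z - j.+1).+1)%N by rewrite -subSn.
rewrite [X in _ <= p ^+ j * X * _ * _]exprS.
set A := p ^+ j; set B := (1 - p) ^+ (z - j.+1); set C := 'C(z, j)%:R in binE *.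
have ABC : 0 <= A * B * C by rewrite !mulr_ge0 ?exprn_ge0 ?subr_ge0.
rewrite [leLHS](_ : _ = A * B * C * (p * (z - j)%:R)); last first.
  rewrite exprS -/A.
  transitivity (p * A * B * ('C(z, j.+1)%:R * j.+1%:R)); first by ring.
  by rewrite binE; ring.
rewrite [leRHS](_ : _ = A * B * C * ((1 - p) * j.+1%:R)); last by ring.
apply: ler_wpM2l => //; rewrite natrB; last exact: ltnW.
have : z%:R * p <= n%:R * p by rewrite ler_wpM2r// ler_nat.
rewrite -[j.+1%:R]natr1; lra.
Qed.

(* Beyond the mean the pmf is at most its average over the r preceding values,
   which is a tail probability divided by r: this replaces a local limit
   estimate. *)
Lemma binomial_pmf_le z n p lambda r j : 0 <= p <= 1 -> 0 <= lambda ->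
  (z <= n)%N -> (0 < r)%N -> n%:R * p <= j%:R - r%:R ->
  binomial_pmf z p j <=
  expR (n%:R * p * (expR lambda - 1) - lambda * (j%:R - r%:R)) / r%:R.
Proof.
move=> p01 l0 zn r0 npj; have [p0 p1] := andP p01.
have rj : (r <= j)%N.
  rewrite -(@ler_nat R) -subr_ge0; apply: le_trans npj; exact: mulr_ge0.
rewrite ler_pdivlMr ?ltr0n// -natrB//.
apply: le_trans (binomial_partial_sum_le (j - r) j p01 l0 zn).
have -> : binomial_pmf z p j * r%:R = \sum_(j - r <= i < j) binomial_pmf z p j.
  by rewrite sumr_const_nat subKn// mulr_natr.
rewrite !big_nat; apply: ler_sum => i /andP[ji /ltnW ij].
have npi : n%:R * p <= i%:R by apply: le_trans npj _; rewrite -natrB// ler_nat.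
elim: j ij {npj rj ji} => [|j IH]; first by rewrite leqn0 => /eqP ->.
rewrite leq_eqVlt => /predU1P[->//|]; rewrite ltnS => ij.
apply: le_trans (IH ij); apply: binomial_pmf_decr zn _ => //.
by apply: le_trans npi _; rewrite ler_nat.
Qed.

End binomial_tail.

(** * From a small gap between the maxima to a close pair of variables *)

Lemma bigmax_nat_attained (r : seq nat) (Q : pred nat) (F : nat -> nat) :
  (\max_(i <- r | Q i) F i = 0)%N \/
  exists i, [/\ i \in r, Q i & (\max_(i <- r | Q i) F i)%N = F i].
Proof.
rewrite big_seq_cond.
apply: (big_ind (fun x => x = 0%N \/ exists i, [/\ i \in r, Q i & x = F i])).
- by left.
- by move=> x y ? ?; rewrite /maxn; case: ifP.
- by move=> i /andP[ir Qi]; right; exists i.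
Qed.

(** Indices attaining the two maxima would form a forbidden pair if the gap were below 2g. The
    condition 2g <= a settles the case where [Zmax2] takes its default value 0. *)
Lemma Zmax2_gap (T : Type) (X : nat -> T -> nat) (k a g : nat) (w : T) :
  (2 * g <= a <= Zmax1 X k w)%N ->
  (forall l l' i, (1 <= l <= k)%N -> (1 <= l' <= k)%N -> l != l' ->
     (i < 2 * g)%N -> (a <= X l w)%N -> X l' w <> (X l w - i)%N) ->
  (Zmax2 X k w + 2 * g <= Zmax1 X k w)%N.
Proof.
move=> /andP[ga aZ] noclose.
have [Z20|[l' [l'k l'Z Z2E]]] :=
    bigmax_nat_attained (index_iota 1 k.+1) (fun l => X l w < Zmax1 X k w)%N (X^~ w).
  by rewrite /Zmax2 Z20 add0n (leq_trans ga).
have [Z10|[l [lk _ Z1E]]] :=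
    bigmax_nat_attained (index_iota 1 k.+1) xpredT (X^~ w).
  by move: l'Z; rewrite /Zmax1 Z10.
rewrite -[Zmax2 X k w]/(\max_(1 <= l < k.+1 | X l w < Zmax1 X k w) X l w)%N Z2E.
rewrite leqNgt; apply/negP => close; move: l'Z close aZ.
rewrite /Zmax1 Z1E => l'Z close aZ.
apply: (noclose l l' (X l w - X l' w)%N); move: lk l'k;
  rewrite ?mem_index_iota; move: (noclose) l'Z close aZ => _; try lia.
by move=> l'Z *; apply/eqP => ll'; rewrite ll' ltnn in l'Z.
Qed.

(** * Measurability, and the union bound over close pairs *)

Section nat_valued_random_variables.
Context d (T : measurableType d) (R : realType) (P : probability T R).

(** The tuple of the X l, l in I, takes countably many values, so an event it determines is a
    countable union of its level sets. This spares separate measurability proofs for each event on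
    the maxima. *)
Lemma measurable_saturated (X : nat -> {RV P >-> nat}) (I : seq nat)
    (E : set T) :
  (forall w w', {in I, forall l, X l w = X l w'} -> E w -> E w') ->
  measurable E.
Proof.
move=> satE; pose f w := [seq X l w | l <- I].
have mf s : d.-measurable [set w | f w = s].
  rewrite /f; elim: I s {satE f} => [|l I IH] [|x s] /=.
  - by rewrite (_ : mkset _ = setT) //; apply/seteqP; split.
  - by rewrite (_ : mkset _ = set0) //; apply/seteqP; split.
  - by rewrite (_ : mkset _ = set0) //; apply/seteqP; split.
  - rewrite (_ : mkset _ = X l @^-1` [set x] `&` [set w | [seq X l w | l <- I] = s]).
      by apply: measurableI => //; exact: measurable_funPTI.
    by apply/seteqP; split => w /=; [case|move=> [-> ->]].
(* [pickle] numbers the tuples; codes not reached from E contribute the empty set. *)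
rewrite (_ : E = \bigcup_n (if `[< exists2 w, E w & pickle (f w) = n >] then
    [set w | pickle (f w) = n] else set0)).
  apply: bigcup_measurable => n _; case: asboolP => // -[w Ew <-].
  rewrite (_ : mkset _ = [set w' | f w' = f w]); first exact: mf.
  apply/seteqP; split => [w' /= /(pcan_inj pickleK)//|w' /= ->//].
apply/seteqP; split => [w Ew|w [n _]].
  exists (pickle (f w)) => //; case: asboolP => // -[]; by exists w.
case: asboolP => // -[w' Ew' <-] /= /(pcan_inj pickleK) /eq_in_map ww'.
by apply: satE Ew' => l lI; rewrite ww'.
Qed.

Lemma union_bound_seq (I : eqType) (s : seq I) (F : I -> set T) (c : R) :
  (forall x, measurable (F x)) -> {in s, forall x, (P (F x) <= c%:E)%E} ->
  (P (\big[setU/set0]_(x <- s) F x) <= ((size s)%:R * c)%:E)%E.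
Proof.
move=> mF; elim: s => [|x s IH] Fc; first by rewrite big_nil measure0 mul0r.
rewrite big_cons -natr1 mulrDl mul1r addrC EFinD.
apply: le_trans (measureU2 _ _ _) _ => //; first exact: bigsetU_measurable.
apply: leeD; first by apply: Fc; rewrite mem_head.
by apply: IH => y ys; apply: Fc; rewrite inE ys orbT.
Qed.

(** Condition on the value m >= a of X: by independence each term is at most P(X = m) c, and these
    sum to at most C c. The tail of X is controlled through its partial sums, so the bound passes to
    the limit. *)
Lemma prob_shifted_pair_le (X Y : {RV P >-> nat}) (a i : nat) (C c : R) :
  (forall m j, P (X @^-1` [set m] `&` Y @^-1` [set j]) =
               P (X @^-1` [set m]) * P (Y @^-1` [set j]))%E ->
  (forall b, \sum_(a <= m < b) P (X @^-1` [set m]) <= C%:E)%E ->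
  0 <= c -> (forall j, (a - i <= j)%N -> P (Y @^-1` [set j]) <= c%:E)%E ->
  (P [set w | (a <= X w)%N /\ Y w = (X w - i)%N] <= (C * c)%:E)%E.
Proof.
move=> XY XC c0 Yc.
pose F m := X @^-1` [set (m + a)%N] `&` Y @^-1` [set (m + a - i)%N].
have mF m : measurable (F m).
  by apply: measurableI; exact: measurable_funPTI.
have -> : [set w | (a <= X w)%N /\ Y w = (X w - i)%N] = \bigcup_m F m.
  apply/seteqP; split => [w [aX YX]|w [m _ [/= XE YE]]] /=.
    by exists (X w - a)%N => //; split => /=; rewrite subnK.
  by rewrite XE YE; split => //; exact: leq_addl.
apply: le_trans (generalized_Boole_inequality _ _ _) _ => //.
  exact: bigcup_measurable.
apply: lime_le; first by apply: is_cvg_nneseries => *; exact: measure_ge0.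
near=> b; rewrite EFinM.
apply: (@le_trans _ _ (\sum_(0 <= m < b) P (X @^-1` [set (m + a)%N]) * c%:E)%E).
  apply: lee_sum => m _; apply: (@le_trans _ _ (P (X @^-1` [set (m + a)%N]) *
      P (Y @^-1` [set (m + a - i)%N]))%E); first by rewrite -XY.
  by rewrite lee_wpmul2l ?measure_ge0// Yc//; lia.
rewrite -ge0_sume_distrl; last by move=> *; exact: measure_ge0.
apply: lee_wpmul2r; first by rewrite lee_fin.
by have := XC (b + a)%N; rewrite -{1}[a]add0n big_addn addnK.
Unshelve. all: by end_near.
Qed.

End nat_valued_random_variables.

Lemma binomial_prob1 (R : realType) z (p : R) j : 0 <= p <= 1 ->
  binomial_prob z p [set j] = (binomial_pmf z p j)%:E.
Proof.
by move=> p01; rewrite /binomial_prob p01 esum_set1// lee_fin binomial_pmf_ge0.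
Qed.

Lemma mutually_independent2 d d' (T : measurableType d) (T' : measurableType d')
    (R : realType) (P : probability T R) (I : set nat) (X : nat -> {RV P >-> T'})
    (l l' : nat) (A B : set T') :
  mutually_independent I X -> I l -> I l' -> l != l' ->
  measurable A -> measurable B ->
  (P (X l @^-1` A `&` X l' @^-1` B) = P (X l @^-1` A) * P (X l' @^-1` B))%E.
Proof.
move=> indep Il Il' ll' mA mB; have l'l : (l' == l) = false by rewrite eq_sym (negbTE ll').
have := indep [:: l; l'] (fun i => if i == l then A else B).
rewrite big_cons big_seq1 eqxx l'l bigcap_seq big_cons big_seq1 eqxx l'l; apply.
- by rewrite /= inE ll'.
- by move=> i; rewrite !inE => /orP[] /eqP ->.
- by move=> i _; case: ifP.
Qed.

Lemma measurable_Zmax d (T : measurableType d) (R : realType)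
    (P : probability T R) (X : nat -> {RV P >-> nat}) (k : nat)
    (Q : nat -> nat -> Prop) :
  measurable [set w | Q (Zmax1 X k w) (Zmax2 X k w)].
Proof.
apply: (@measurable_saturated _ _ _ _ X (iota 1 k)) => w w' ww'.
have {}ww' l : (1 <= l < k.+1)%N -> X l w = X l w'.
  by move=> lk; rewrite ww'// mem_iota add1n.
have Z1E : Zmax1 X k w = Zmax1 X k w' by apply: eq_big_nat.
suff Z2E : Zmax2 X k w = Zmax2 X k w' by rewrite /mkset Z1E Z2E.
rewrite /Zmax2 Z1E big_nat_cond [RHS]big_nat_cond.
apply: eq_big => l; last by move=> /andP[lk _]; rewrite ww'.
by case: (boolP (1 <= l < k.+1)%N) => //= lk; rewrite ww'.
Qed.

Lemma prob_Zmax2_gap d (T : measurableType d) (R : realType)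
    (P : probability T R) (X : nat -> {RV P >-> nat}) (k n : nat)
    (z : nat -> nat) (p lambda : R) (a g r : nat)
    (C := expR (n%:R * p * (expR lambda - 1) - lambda * a%:R)) :
  0 <= p <= 1 -> 0 <= lambda -> (0 < r)%N ->
  (forall l, (1 <= l <= k)%N -> (z l <= n)%N) ->
  (forall l, (1 <= l <= k)%N ->
    distribution P (X l) = binomial_prob (z l) p) ->
  mutually_independent [set l | (1 <= l <= k)%N] X ->
  n%:R * p <= a%:R - 2 * g%:R - r%:R ->
  (P [set w | (a <= Zmax1 X k w)%N] <=
   P [set w | ((Zmax2 X k w)%:Z <= (Zmax1 X k w)%:Z - 2 * g%:Z)%R] +
   ((k * k * (2 * g))%N%:R *
      (C * (C * expR (lambda * (2 * g%:R + r%:R)) / r%:R)))%:E)%E.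
Proof.
move=> p01 l0 r0 zn law indep npa; have [p0 p1] := andP p01.
have ga : (2 * g <= a)%N.
  rewrite -(ler_nat R) natrM -subr_ge0.
  by apply: le_trans (_ : n%:R * p + r%:R <= _); [rewrite addr_ge0 ?mulr_ge0|lra].
have lawE l j : (1 <= l <= k)%N ->
    P (X l @^-1` [set j]) = (binomial_pmf (z l) p j)%:E.
  by move=> lk; rewrite -binomial_prob1// -law.
(* c bounds every P(X l' = j) with j >= a - 2g: lowering the Chernoff threshold from a to a - 2g - r
   costs the exponential factor. *)
set c := C * expR _ / r%:R.
have c0 : 0 <= c by rewrite !mulr_ge0 ?expR_ge0 ?invr_ge0.
(* The condition l != l' sits in the event, not in the index set: diagonal events are empty, and the
   index list remains a plain product of size k * k * 2g. *)
pose F (x : nat * nat * nat) :=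
  let: (l, l', i) := x in
  [set w | l != l' /\ (a <= X l w)%N /\ X l' w = (X l w - i)%N].
pose s := [seq (x, i) | x <- [seq (l, l') | l <- iota 1 k, l' <- iota 1 k],
                        i <- iota 0 (2 * g)].
have mF x : measurable (F x).
  case: x => [[l l'] i]; apply: (@measurable_saturated _ _ _ _ X [:: l; l']).
  by move=> w w' ww'; rewrite /F/= !ww' ?inE ?eqxx ?orbT.
have mZ1 : measurable [set w | (a <= Zmax1 X k w)%N].
  exact: (measurable_Zmax X k (fun z1 _ => (a <= z1)%N)).
have mZ2 : measurable [set w | (Zmax2 X k w)%:Z <= (Zmax1 X k w)%:Z - 2 * g%:Z].
  exact: (measurable_Zmax X k (fun z1 z2 => z2%:Z <= z1%:Z - 2 * g%:Z)).
have FC x : x \in s -> (P (F x) <= (C * c)%:E)%E.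
  case: x => [[l l'] i] /allpairsP[[x i'] /= [/allpairsP[[l1 l1'] /= [lk lk' ->]]]].
  move=> ik [El El' Ei]; subst l1 l1' i'.
  move: lk lk'; rewrite !mem_iota !add1n !ltnS => lk lk'.
  have i2g : (i < 2 * g)%N by move: ik; rewrite mem_iota.
  have [<-{lk' l'}|ll'] := eqVneq l l'.
    rewrite [X in P X](_ : _ = set0) ?measure0 ?lee_fin ?mulr_ge0 ?expR_ge0//.
    by apply/seteqP; split => // w [].
  rewrite [X in P X](_ : _ = [set w | (a <= X l w)%N /\ X l' w = (X l w - i)%N]); last first.
    by apply/seteqP; split => w; [case|].
  apply: prob_shifted_pair_le => //.
  - by move=> m j; exact: mutually_independent2 indep _ _ _ _ _.
  - move=> b; under eq_bigr do rewrite lawE//.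
    by rewrite sumEFin lee_fin; apply: binomial_partial_sum_le => //; exact: zn.
  - move=> j aj; rewrite lawE// lee_fin.
    have aj' : a%:R - 2 * g%:R <= j%:R :> R.
      by rewrite -natrM -natrB// ler_nat; lia.
    apply: le_trans (binomial_pmf_le p01 l0 (zn _ lk') r0 _) _; first by lra.
    rewrite /c -expRD ler_wpM2r ?invr_ge0// ler_expR.
    have := ler_wpM2l l0 aj'; lra.
have sub : [set w | (a <= Zmax1 X k w)%N] `<=`
    [set w | (Zmax2 X k w)%:Z <= (Zmax1 X k w)%:Z - 2 * g%:Z] `|`
    \big[setU/set0]_(x <- s) F x.
  move=> w /= aZ; have [|nB] := pselect ((\big[setU/set0]_(x <- s) F x) w); first by right.
  left => /=; suff : (Zmax2 X k w + 2 * g <= Zmax1 X k w)%N.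
    by rewrite lerBrDr -PoszM -PoszD lez_nat.
  apply: (@Zmax2_gap _ _ k a); first by rewrite ga.
  move=> l l' i lk lk' ll' ig aX XX; apply: nB; rewrite -bigcup_seq.
  exists (l, l', i) => //=; apply/allpairsP; exists ((l, l'), i); split => //=.
    by apply/allpairsP; exists (l, l'); split; rewrite //= mem_iota add1n ltnS.
  by rewrite mem_iota.
apply: le_trans (le_measure _ _ _ sub) _; rewrite ?inE//.
  by apply: measurableU => //; exact: bigsetU_measurable.
apply: le_trans (measureU2 _ _ _) _ => //; first exact: bigsetU_measurable.
apply: leeD => //; apply: le_trans (union_bound_seq mF FC) _.
by rewrite !size_allpairs !size_iota.
Qed.

(** * Numerical estimate of the error term *)

Lemma expR_ge_monomial (R : realType) (x : R) (m : nat) : 0 <= x ->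
  x ^+ m.+1 / m.+1`!%:R <= expR x.
Proof.
by move=> x0; apply: le_trans (expR_ge1Dxn m x0); rewrite lerDr ler01.
Qed.

(* Here y = sqrt(ln(np)), exp(-L) = np^3, e = eps_n and a = M_n + 1; the window
   length r is about (np)^((1 - e) / 2), halfway (on a logarithmic scale) between
   gamma_n and sqrt(np). *)
Lemma gap_error_le (R : realType) (y L e a : R) (k g r : nat)
    (N := expR (y ^+ 2)) (E := expR (y ^+ 2 / 2)) (sigma := Num.sqrt ((1 - e / 2) * L))
    (lambda := sigma / E)
    (C := expR (N * (expR lambda - 1) - lambda * a)) :
  17 <= y -> 2 <= L <= y ^+ 2 / 5 -> y^-1 <= e <= 2^-1 ->
  k%:R <= 2^-1 * Num.sqrt (L * expR L / 2) + 1 ->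
  g%:R <= expR ((2^-1 - e) * y ^+ 2) + 1 ->
  expR (y ^+ 2 / 2 - e * y ^+ 2 / 2) <= r%:R <=
    expR (y ^+ 2 / 2 - e * y ^+ 2 / 2) + 1 ->
  N + sigma * E <= a ->
  N <= a - 2 * g%:R - r%:R /\
  (k * k * (2 * g))%:R *
    (C * (C * expR (lambda * (2 * g%:R + r%:R)) / r%:R)) <=
  400 * expR 3 / y.
Proof.
move=> y17 /andP[L2 Ly] /andP[ye e2] kle gle /andP[rge rle] age.
have y0 : 0 < y by lra.
have e0 : 0 < e by apply: lt_le_trans ye; rewrite invr_gt0.
have ey1 : 1 <= e * y by rewrite -ler_pdivrMr// mul1r.
(* w = N^(e/2) separates the three scales: E = sqrt N, the window E / w, and gamma = E / w^2. *)
pose w := expR (e * y ^+ 2 / 2).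
have E0 : 0 < E by exact: expR_gt0.
have w0 : 0 < w by exact: expR_gt0.
have NE : N = E * E by rewrite /N /E -expRD; congr expR; lra.
(* Since e y >= 1, w >= exp(y / 2) >= y^3 / 48, and this is at least 6y when y^2 >= 288; hence the
   threshold 17. *)
have w6 : 6 * y <= w.
  have y2 : 0 <= y / 2 by lra.
  have := @expR_ge_monomial _ (y / 2) 2 y2; rewrite (_ : 3`!%:R = 6 :> R)// => h.
  have h1 : expR (y / 2) <= w by rewrite ler_expR; nra.
  apply: le_trans h1; apply: le_trans h; nra.
have wE : w * w <= E.
  by rewrite -expRD ler_expR; nra.
have sig0 : 0 <= sigma by exact: sqrtr_ge0.
have sig2 : sigma * sigma = (1 - e / 2) * L by rewrite -expr2 sqr_sqrtr//; nra.
have sigy : sigma <= y by rewrite -(@ler_pXn2r _ 2)// ?nnegrE ?(ltW y0)// expr2 sig2; nra.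
have sig1 : 1 <= sigma by rewrite -(@ler_pXn2r _ 2)// ?nnegrE// expr1n expr2 sig2; nra.
have yE : y ^+ 3 <= E.
  have y2 : 0 <= y ^+ 2 / 2 by nra.
  have := @expR_ge_monomial _ (y ^+ 2 / 2) 1 y2; rewrite (_ : 2`!%:R = 2 :> R)// => h.
  apply: le_trans h; nra.
have l0 : 0 <= lambda by rewrite divr_ge0// ltW.
have lE : lambda * E = sigma by rewrite /lambda -mulrA mulVf ?mulr1// gt_eqF.
have l1 : lambda <= 1.
  rewrite /lambda ler_pdivrMr// mul1r; apply: le_trans sigy (le_trans _ yE); nra.
have Ew : expR (y ^+ 2 / 2 - e * y ^+ 2 / 2) = E / w by rewrite expRD expRN.
have Eww : expR ((2^-1 - e) * y ^+ 2) = E / w / w.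
  by rewrite /w /E -!expRN -!expRD; congr expR; lra.
have Eww1 : 1 <= E / w / w by rewrite ler_pdivlMr// ler_pdivlMr// mul1r.
rewrite {}Ew in rge rle; rewrite {}Eww in gle.
set v := E / w in rge rle gle Eww1.
have v0 : 0 < v by rewrite divr_gt0.
have vw : v * w = E by rewrite /v -mulrA mulVf ?mulr1// gt_eqF.
have gv : g%:R * w <= 2 * v.
  have : v / w * w = v by rewrite -mulrA mulVf ?mulr1// gt_eqF.
  nra.
have v1 : 1 <= v by nra.
have D6 : 2 * g%:R + r%:R <= 6 * v.
  have : (0 : R) <= g%:R by []. 
  nra.
have D0 : 0 <= 2 * g%:R + r%:R :> R by rewrite addr_ge0// mulr_ge0.
have v6E : 6 * v <= E by nra.
split; first by nra.
(* Lowering the threshold thus costs at most a factor e: lambda * 6v * w = 6 sigma <= 6y <= w. *)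
have lD : lambda * (2 * g%:R + r%:R) <= 1.
  apply: le_trans (_ : lambda * (6 * v) <= 1); first exact: ler_wpM2l.
  have : lambda * (6 * v) * w <= 1 * w by nra.
  by rewrite ler_pM2r.
(* lambda = sigma / E minimises the quadratic approximation N lambda^2 / 2 - lambda sigma E of the
   exponent, with value - sigma^2 / 2; the cubic remainder is N lambda^3 = sigma^3 / E <= y^3 / E <=
   1. *)
have Cle : C <= expR (1 - sigma * sigma / 2).
  rewrite ler_expR.
  have l01 : 0 <= lambda <= 1 by rewrite l0.
  have h1 := expR_le_cubic l01.
  have h2 : lambda * N = sigma * E by rewrite NE mulrA lE.
  have h3 : lambda * (N + sigma * E) <= lambda * a by exact: ler_wpM2l.
  have h4 : N * (expR lambda - 1) <= N * (lambda + lambda ^+ 2 / 2 + lambda ^+ 3).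
    by apply: ler_wpM2l; [exact: expR_ge0|lra].
  have h5 : N * lambda ^+ 2 = sigma * sigma by rewrite NE -lE; ring.
  have h6 : N * lambda ^+ 3 <= 1.
    have : N * lambda ^+ 3 * E <= 1 * E; last by rewrite ler_pM2r.
    rewrite (_ : N * lambda ^+ 3 * E = sigma ^+ 3); last by rewrite NE -lE; ring.
    by rewrite mul1r; apply: le_trans yE; rewrite lerXn2r ?nnegrE// ltW.
  have h7 : N * (lambda + lambda ^+ 2 / 2 + lambda ^+ 3) =
      sigma * E + sigma * sigma / 2 + N * lambda ^+ 3.
    by rewrite -h5 -h2; ring.
  have h8 : lambda * (N + sigma * E) = sigma * E + sigma * sigma.
    by rewrite mulrDr h2 mulrCA lE.
  lra.
have C0 : 0 <= C by exact: expR_ge0.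
have r0 : (0 : R) < r%:R by exact: lt_le_trans rge.
(* The factor exp(-L) here compensates the k^2 <= L exp(L) pairs. *)
have CC : C * (C * expR (lambda * (2 * g%:R + r%:R)) / r%:R) <=
    expR 3 * expR (e * L / 2) / expR L / v.
  rewrite -mulrA [X in C * X]mulrA mulrA.
  apply: ler_pM; rewrite ?invr_ge0 ?ler0n ?mulr_ge0 ?expR_ge0//; last first.
    by rewrite lef_pV2 ?posrE.
  apply: (@le_trans _ _ (expR (1 - sigma * sigma / 2) *
      (expR (1 - sigma * sigma / 2) * expR 1))).
    rewrite !ler_pM ?mulr_ge0 ?expR_ge0//.
    by rewrite ler_expR.
  rewrite -expRN -!expRD ler_expR; lra.
(* With t^2 = L exp(L) / 2, the main term t^2 / 4 leaves room for the rounding error in k, because L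
   exp(L) >= 6. *)
have kk : (k * k)%:R <= L * expR L.
  rewrite natrM.
  have L0 : 0 <= L * expR L / 2 by rewrite divr_ge0// mulr_ge0 ?expR_ge0//; lra.
  have eL : 1 + L <= expR L by exact: expR_ge1Dx.
  have := sqr_sqrtr L0; have := sqrtr_ge0 (L * expR L / 2).
  move: (Num.sqrt _) kle => t kle t0 t2.
  have k0 : (0 : R) <= k%:R by [].
  have : k%:R * k%:R <= (2^-1 * t + 1) * (2^-1 * t + 1) :> R by exact: ler_pM.
  have : 6 <= L * expR L by nra.
  have := sqr_ge0 (t - 1); lra.
rewrite natrM [(2 * g)%:R]natrM.
apply: (@le_trans _ _ (L * expR L * (2 * (2 * v / w)) *
    (expR 3 * expR (e * L / 2) / expR L / v))).
  apply: ler_pM; rewrite ?mulr_ge0 ?invr_ge0 ?expR_ge0//.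
  apply: ler_pM => //; rewrite ler_pM2l//.
  by rewrite ler_pdivlMr.
rewrite (_ : _ * _ = 4 * expR 3 * L * (expR (e * L / 2) / w)); last first.
  by field; rewrite ?gt_eqF ?expR_gt0.
have -> : 400 * expR 3 / y = 4 * expR 3 * (100 / y) by ring.
rewrite -[leLHS]mulrA ler_wpM2l ?mulr_ge0 ?expR_ge0//.
have x0 : 0 <= 2 / 5 * y by lra.
have := @expR_ge_monomial _ (2 / 5 * y) 2 x0; rewrite (_ : 3`!%:R = 6 :> R)// => h.
(* L <= y^2 / 5 makes the exponent at most - (2/5) e y^2, and e y >= 1. The exponential in y then
   beats the remaining factor L <= y^2 / 5 through its cubic term. *)
have wL : expR (e * L / 2) / w <= (expR (2 / 5 * y))^-1.
  by rewrite /w -!expRN -expRD ler_expR; nra.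
apply: le_trans (_ : y ^+ 2 / 5 * ((2 / 5 * y) ^+ 3 / 6)^-1 <= _).
  apply: ler_pM => //; first by lra.
    by rewrite divr_ge0 ?expR_ge0.
  apply: le_trans wL _; rewrite lef_pV2 ?posrE ?expR_gt0//.
  by rewrite divr_gt0// exprn_gt0//; lra.
rewrite [leLHS](_ : _ = (75 / 4) / y); last by field; rewrite gt_eqF.
by rewrite ler_pM2r ?invr_gt0//; lra.
Qed.

(** * Rounding, and estimates of the parameters for a fixed large n *)

Section rounding.
Context {R : realType}.
Implicit Types (x : R) (m n : nat).

Lemma is_rounding_itv x m : is_rounding x m -> x - 1 < m%:R < x + 1.
Proof.
rewrite /is_rounding -[m%:R]/(m%:Z%:~R) => -[] ->.
  by have := floor_itv x; rewrite intrD; lra.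
by have := ceil_itv x; rewrite intrB; lra.
Qed.

Lemma is_rounding_le_nat x m n : is_rounding x m -> x <= n%:R -> (m <= n)%N.
Proof.
move=> /is_rounding_itv/andP[_ mx] xn.
by rewrite -ltnS -(ltr_nat R) -natr1 (lt_le_trans mx)// lerD2r.
Qed.

End rounding.

Section parameter_estimates.
Context {R : realType} (p : nat -> R) (n : nat).
Local Notation N := (n%:R * p n).
Local Notation L := (ln (1 / (n%:R * p n ^+ 3))).
Local Notation y := (Num.sqrt (ln N)).

Hypothesis p01 : 0 <= p n <= 1.
Hypothesis y17 : 17 <= y.
(** Fixed-n forms of the two growth conditions: the first yields L <= y^2 / 5, and the constant
    exp(-1) in the second keeps L above 2. *)
Hypothesis N_ge : (n%:R : R) `^ (5 / 8) <= N.
Hypothesis N_le : N <= expR (-1) * n%:R `^ (2 / 3).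

(** [Num.sqrt] is 0 at negative numbers and [ln] is 0 at nonpositive ones, so y >= 17 alone forces
    ln N, and then N, n and p, to be positive. *)
Lemma sqr_sqrt_ln_np : y ^+ 2 = ln N.
Proof.
rewrite sqr_sqrtr// leNgt; apply/negP => /ltW h.
by move: y17; rewrite ler0_sqrtr//; lra.
Qed.

Lemma np_gt0 : 0 < N.
Proof.
rewrite ltNge; apply/negP => /ln0; rewrite -sqr_sqrt_ln_np; have := y17; nra.
Qed.

Lemma natr_gt0_of_np : 0 < n%:R :> R.
Proof.
rewrite lt_neqAle ler0n andbT; apply/negP => /eqP n0.
by have := np_gt0; rewrite -n0 mul0r ltxx.
Qed.

Lemma p_gt0 : 0 < p n.
Proof. by have := np_gt0; rewrite pmulr_rgt0// natr_gt0_of_np. Qed.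

Lemma np_expR : N = expR (y ^+ 2).
Proof. by rewrite sqr_sqrt_ln_np lnK// posrE np_gt0. Qed.

Lemma sqrt_np : Num.sqrt N = expR (y ^+ 2 / 2).
Proof.
rewrite -[RHS]ger0_norm ?expR_ge0// -sqrtr_sqr; congr Num.sqrt.
by rewrite {1}np_expR -expRM_natl; congr expR; lra.
Qed.

Lemma ln_n_bounds : 3 / 2 * (y ^+ 2 + 1) <= ln n%:R <= 8 / 5 * y ^+ 2.
Proof.
have n0 := natr_gt0_of_np; have p0 := p_gt0; have N0 := np_gt0.
have h1 : ln ((n%:R : R) `^ (5 / 8)) <= ln N by rewrite ler_ln ?posrE ?powR_gt0.
have h2 : ln N <= ln (expR (-1) * n%:R `^ (2 / 3)).
  by rewrite ler_ln ?posrE ?mulr_gt0 ?expR_gt0 ?powR_gt0.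
rewrite [X in _ <= X]lnM ?posrE ?expR_gt0 ?powR_gt0// expRK in h2.
by move: h1 h2; rewrite !ln_powR sqr_sqrt_ln_np; lra.
Qed.

Lemma ln_inv_np3E : L = 2 * ln n%:R - 3 * y ^+ 2.
Proof.
have n0 := natr_gt0_of_np; have p0 := p_gt0.
have q0 : 0 < p n ^+ 3 by rewrite exprn_gt0.
have hN : ln N = ln n%:R + ln (p n) by rewrite lnM ?posrE.
have hq : ln (n%:R * p n ^+ 3) = ln n%:R + 3 * ln (p n).
  by rewrite lnM ?posrE// lnXn// mulr_natl.
by rewrite div1r lnV ?posrE ?mulr_gt0// sqr_sqrt_ln_np hN hq; lra.
Qed.

Lemma ln_inv_np3_bounds : 2 <= L <= y ^+ 2 / 5.
Proof. by rewrite ln_inv_np3E; have := ln_n_bounds; lra. Qed.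

Lemma inv_np3_expR : 1 / (n%:R * p n ^+ 3) = expR L.
Proof.
by rewrite lnK// posrE divr_gt0// mulr_gt0 ?exprn_gt0 ?natr_gt0_of_np ?p_gt0.
Qed.

Lemma kstarE : kstar p n = 2^-1 * Num.sqrt (L * expR L / 2).
Proof.
have n0 := natr_gt0_of_np; have p0 := p_gt0.
rewrite /kstar -inv_np3_expR; congr (_ * Num.sqrt _).
by field; rewrite ?gt_eqF.
Qed.

Lemma kstar_ge0 : 0 <= kstar p n.
Proof. by rewrite kstarE mulr_ge0 ?sqrtr_ge0. Qed.

Lemma MparE (eps : nat -> R) : eps n <= 2^-1 ->
  Mpar p eps n = N + Num.sqrt ((1 - eps n / 2) * L) * expR (y ^+ 2 / 2).
Proof.
move=> e2; have /andP[L2 _] := ln_inv_np3_bounds.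
rewrite /Mpar -sqrt_np -sqrtrM; last by rewrite mulr_ge0; lra.
by congr (_ + Num.sqrt _); ring.
Qed.

Lemma gammaparE (eps : nat -> R) :
  gammapar p eps n = expR ((2^-1 - eps n) * y ^+ 2).
Proof. by rewrite /gammapar /powR gt_eqF ?np_gt0// sqr_sqrt_ln_np. Qed.

(** Brings the indices up to [ks] into the range where laws and independence are assumed. Here
    [kstar]^2 = L exp(L) / 8, while the square of A = p^(-2) sqrt(ln n / n) is at least exp(L) ln
    n. *)
Lemma kstar_le_kbound (ks : nat) : is_rounding (kstar p n) ks ->
  (ks <= 2 * kbound p n)%N.
Proof.
move=> /is_rounding_itv/andP[_ kskstar].
have n0 := natr_gt0_of_np; have p0 := p_gt0; have /andP[_ p1] := p01.
set A := p n ^- 2 * Num.sqrt (n%:R^-1 * ln n%:R).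
have /andP[lnn _] := ln_n_bounds; have /andP[L2 Ly] := ln_inv_np3_bounds.
have y2 : 289 <= y ^+ 2 by have := ler_pM _ _ y17 y17; rewrite -expr2; lra.
have l0 : 0 <= n%:R^-1 * ln n%:R :> R.
    by apply: mulr_ge0; [rewrite invr_ge0|lra].
have A0 : 0 <= A by rewrite /A mulr_ge0 ?sqrtr_ge0 ?invr_ge0 ?exprn_ge0// ltW.
have A2 : expR L * ln n%:R <= A ^+ 2.
  rewrite -inv_np3_expR /A exprMn sqr_sqrtr//.
  rewrite mul1r invfM -!exprVn.
  have : 1 <= (p n)^-1 by rewrite invf_ge1.
  set q := (p n)^-1 => q1.
  have : 0 <= q ^+ 3 * (n%:R^-1 * ln n%:R) by rewrite mulr_ge0// exprn_ge0//; lra.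
  nra.
have eL : 1 + L <= expR L by exact: expR_ge1Dx.
have A1 : 1 <= A by rewrite -(@ler_pXn2r _ 2)// ?nnegrE// expr1n; nra.
have kA : kstar p n <= A.
  rewrite -(@ler_pXn2r _ 2)// ?nnegrE ?kstar_ge0// kstarE exprMn sqr_sqrtr; nra.
have kb : 15 * A <= (kbound p n)%:R.
  rewrite /kbound natr_absz ger0_norm.
    by apply: le_trans (ceil_ge _); rewrite /A mulrA.
  by rewrite -(ler_int R); apply: le_trans (ceil_ge _); rewrite -mulrA -/A; lra.
rewrite -(ler_nat R) natrM; lra.
Qed.

(** z_l = n - (l - 1) np (1 - (l - 2) p / 2), and the last factor is nonnegative because ([kstar]
    p)^2 = L / (8 np) <= 1. *)
Lemma zpar_le (ks l : nat) : is_rounding (kstar p n) ks -> (1 <= l <= ks)%N ->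
  zpar p n l <= n%:R.
Proof.
move=> /is_rounding_itv/andP[_ kskstar] /andP[l1 lks].
have n0 := natr_gt0_of_np; have p0 := p_gt0; have /andP[_ p1] := p01.
have /andP[L2 Ly] := ln_inv_np3_bounds.
have kp : kstar p n * p n <= 1.
  rewrite -(@ler_pXn2r _ 2)// ?nnegrE ?mulr_ge0 ?kstar_ge0 ?(ltW p0)//.
  rewrite expr1n kstarE !exprMn sqr_sqrtr; last first.
    by rewrite divr_ge0// mulr_ge0 ?expR_ge0//; lra.
  rewrite -inv_np3_expR [leLHS](_ : _ = L / (8 * N)); last by field; rewrite ?gt_eqF.
  rewrite ler_pdivrMr ?mulr_gt0 ?np_gt0//.
  by have := expR_ge1Dx (y ^+ 2); rewrite -np_expR; have := sqr_ge0 y; lra.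
have lk : l%:R < kstar p n + 1 by apply: le_lt_trans kskstar; rewrite ler_nat.
have lp : (l%:R - 2) * p n <= 2.
  by apply: le_trans (_ : kstar p n * p n <= _); [rewrite ler_pM2r//; lra|lra].
have l1' : 0 <= (l%:R - 1) * N :> R.
  by rewrite mulr_ge0 ?(ltW np_gt0)// subr_ge0 ler1n.
rewrite /zpar (_ : _ + _ = n%:R - (l%:R - 1) * N * (1 - (l%:R - 2) * p n / 2)).
  by rewrite gerBl mulr_ge0//; lra.
by field.
Qed.

End parameter_estimates.

(** * The gap bound for the actual parameters, and the limit *)

Lemma prob_Zmax2_gap_asymptotic d (T : measurableType d) (R : realType)
    (P : probability T R) (Z : nat -> {RV P >-> nat}) (z : nat -> nat)
    (p eps : nat -> R) (n ks M gam : nat) (y := Num.sqrt (ln (n%:R * p n))) :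
  0 <= p n <= 1 -> 17 <= y -> (n%:R : R) `^ (5 / 8) <= n%:R * p n ->
  n%:R * p n <= expR (-1) * n%:R `^ (2 / 3) ->
  (forall l, (1 <= l <= 2 * kbound p n)%N -> is_rounding (zpar p n l) (z l)) ->
  is_rounding (kstar p n) ks ->
  (forall l, (1 <= l <= 2 * kbound p n)%N ->
    distribution P (Z l) = binomial_prob (z l) (p n)) ->
  mutually_independent [set l | (1 <= l <= 2 * kbound p n)%N] Z ->
  y^-1 <= eps n <= 2^-1 ->
  is_rounding (Mpar p eps n) M -> is_rounding (gammapar p eps n) gam ->
  (P [set w | (M < Zmax1 Z ks w)%N] <=
   P [set w | ((Zmax2 Z ks w)%:Z <= (Zmax1 Z ks w)%:Z - 2 * gam%:Z)%R] +
   (400 * expR 3 / y)%:E)%E.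
Proof.
move=> p01 y17 N_ge N_le zpar_z ksr law indep eps_itv Mr gamr.
have kskb := kstar_le_kbound p01 y17 N_ge N_le ksr.
have lekb l : (1 <= l <= ks)%N -> (1 <= l <= 2 * kbound p n)%N by lia.
have L_itv := ln_inv_np3_bounds y17 N_ge N_le.
have /andP[ye e2] := eps_itv.
pose t := expR (y ^+ 2 / 2 - eps n * y ^+ 2 / 2).
pose r := (Num.trunc t).+1.
have t0 : 0 <= t by exact: expR_ge0.
have r_itv : t <= r%:R <= t + 1.
  by have /andP[h1 h2] := truncn_itv t0; rewrite ltW//= -natr1 lerD2r.
have kle : ks%:R <= 2^-1 * Num.sqrt (ln (1 / (n%:R * p n ^+ 3)) *
    expR (ln (1 / (n%:R * p n ^+ 3))) / 2) + 1.
  by rewrite -kstarE//; have /andP[_ /ltW] := is_rounding_itv ksr.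
have gle : gam%:R <= expR ((2^-1 - eps n) * y ^+ 2) + 1.
  by rewrite -gammaparE//; have /andP[_ /ltW] := is_rounding_itv gamr.
have age := is_rounding_itv Mr.
rewrite (MparE y17 N_ge N_le e2) in age.
set sigma := Num.sqrt _ in age.
(* The event M < [Zmax1] has integer threshold M + 1, which is at least the unrounded M_n whichever
   way M was rounded. *)
have {}age : expR (y ^+ 2) + sigma * expR (y ^+ 2 / 2) <= M.+1%:R.
  by rewrite -natr1 -(np_expR y17) -/y; move: age; rewrite -/y; lra.
have [np_le err_le] := gap_error_le y17 L_itv eps_itv kle gle r_itv age.
have p0 := p_gt0 y17.
have l0 : 0 <= sigma / expR (y ^+ 2 / 2) by rewrite divr_ge0 ?sqrtr_ge0 ?expR_ge0.
rewrite -/sigma -(np_expR y17) in np_le err_le.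
apply: le_trans (@prob_Zmax2_gap _ _ _ P Z ks n z (p n) _ M.+1 gam r p01 l0 isT _ _ _ np_le) _.
- move=> l lks; apply: is_rounding_le_nat (zpar_z _ (lekb _ lks)) _.
  exact: (zpar_le p01 y17 N_ge N_le ksr).
- by move=> l /lekb; exact: law.
- by move=> s A us sks; apply: indep us _ => i /sks /lekb.
- by rewrite leeD2l// lee_fin.
Qed.

Theorem lemma3p28 (R : realType) (epsilon : R) (p : nat -> R)
  (d : nat -> measure_display) (T : forall n, measurableType (d n))
  (P : forall n, probability (T n) R)
  (Z : forall n, nat -> {RV (P n) >-> nat})
  (z : nat -> nat -> nat) (ks M gam : nat -> nat) (eps : nat -> R)
  (epsilon_itv : 0 < epsilon < 1 / 24)
  (p01 : forall n, 0 <= p n <= 1)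
  (p_lower : \forall n \near \oo,
    (n%:R : R) `^ (5 / 8 + epsilon) <= n%:R * p n)
  (p_upper : (fun n => n%:R * p n) =o_\oo (fun n => (n%:R : R) `^ (2 / 3)))
  (z_def : \forall n \near \oo, forall l, (1 <= l <= 2 * kbound p n)%N ->
    is_rounding (zpar p n l) (z n l))
  (ks_def : \forall n \near \oo, is_rounding (kstar p n) (ks n))
  (Z_law : forall n l, (1 <= l <= 2 * kbound p n)%N ->
    distribution (P n) (Z n l) = binomial_prob (z n l) (p n))
  (Z_indep : forall n,
    mutually_independent [set l | (1 <= l <= 2 * kbound p n)%N] (Z n))
  (eps_gt0 : forall n, (1 <= n)%N -> 0 < eps n)
  (eps_cvg0 : eps n @[n --> \oo] --> (0 : R))
  (eps_lower : \forall n \near \oo, (ln (n%:R * p n)) `^ (- 2^-1) <= eps n)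
  (M_def : \forall n \near \oo, is_rounding (Mpar p eps n) (M n))
  (M_aas : aas P (fun n => [set w | (M n < Zmax1 (Z n) (ks n) w)%N]))
  (gam_def : \forall n \near \oo, is_rounding (gammapar p eps n) (gam n)) :
  aas P (fun n => [set w | (Zmax2 (Z n) (ks n) w)%:Z <=
                           (Zmax1 (Z n) (ks n) w)%:Z - 2 * (gam n)%:Z]).
Proof.
pose y n := Num.sqrt (ln (n%:R * p n)).
have /andP[ep0 _] := epsilon_itv.
have N_ge : \forall n \near \oo, (n%:R : R) `^ (5 / 8) <= n%:R * p n.
  near=> n; apply: le_trans (_ : _ <= (n%:R : R) `^ (5 / 8 + epsilon)) _.
    apply: ler_powR; last by lra.
    by rewrite ler1n; near: n; exact: nbhs_infty_gt.
  by near: n.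
have N_le : \forall n \near \oo, n%:R * p n <= expR (-1) * (n%:R : R) `^ (2 / 3).
  have := eqoP \oo (fun n => (n%:R : R) `^ (2 / 3)) (fun n => n%:R * p n).
  move=> /iffLR /(_ p_upper _ (expR_gt0 (-1))); apply: filterS => n.
  rewrite !ger0_norm ?powR_ge0// mulr_ge0//.
  by case/andP: (p01 n).
(* y tends to infinity, since y^2 = ln(np) >= (5/8) ln n. *)
have y_ge A : \forall n \near \oo, A <= y n.
  near=> n; have n0 : 0 < n%:R :> R by rewrite ltr0n; near: n; exact: nbhs_infty_gt.
  have nN : (n%:R : R) `^ (5 / 8) <= n%:R * p n by near: n.
  have N0 : 0 < n%:R * p n by apply: lt_le_trans nN; exact: powR_gt0.
  have ln_n : 2 * A ^+ 2 <= ln n%:R.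
    rewrite -[leLHS]expRK ler_ln ?posrE ?expR_gt0//.
    by near: n; exact: nbhs_infty_ger.
  have : 5 / 8 * ln n%:R <= ln (n%:R * p n).
    by rewrite -ln_powR ler_ln ?posrE ?powR_gt0.
  move=> lnN; apply: le_trans (ler_norm A) _; rewrite -sqrtr_sqr ler_wsqrtr//.
  have := sqr_ge0 A; lra.
(* The target probability is squeezed between this and 1; the first term tends to 1 by [M_aas] and
   the error to 0 as y grows. *)
pose lo n : \bar R := (P n [set w | (M n < Zmax1 (Z n) (ks n) w)%N] -
  (400 * expR 3 * (y n)^-1)%:E)%E.
have gap : \forall n \near \oo,
    (lo n <= P n [set w | ((Zmax2 (Z n) (ks n) w)%:Z <=
                   (Zmax1 (Z n) (ks n) w)%:Z - 2 * (gam n)%:Z)%R] <= 1)%E.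
  near=> n; apply/andP; split; last first.
    apply: probability_le1.
    exact: (measurable_Zmax (Z n) (ks n)
      (fun z1 z2 => z2%:Z <= z1%:Z - 2 * (gam n)%:Z)).
  rewrite /lo leeBlDr//.
  have y17 : 17 <= y n by near: n; exact: y_ge.
  have lnN0 : 0 <= ln (n%:R * p n) by rewrite -(sqr_sqrt_ln_np y17) sqr_ge0.
  have eps_itv : (y n)^-1 <= eps n <= 2^-1.
    apply/andP; split; first by rewrite /y -powR12_sqrt// -powRN; near: n.
    by near: n; apply: cvgr_le eps_cvg0 _ _; lra.
  by apply: (prob_Zmax2_gap_asymptotic (p01 n) y17 _ _ _ _ (Z_law n) (Z_indep n)
    eps_itv); near: n.
have lo_cvg : lo n @[n --> \oo] --> 1%E.
  rewrite -[X in _ --> X]sube0; apply: cvgeB => //.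
  apply: cvg_EFin; first exact: nearW.
  rewrite -[X in _ --> X](mulr0 (400 * expR 3)).
  apply: cvgM; first exact: cvg_cst.
  apply/gtr0_cvgV0; last by apply/cvgryPge.
  by near=> n; apply: lt_le_trans (_ : 1 <= _) => //; near: n.
apply: (squeeze_cvge gap lo_cvg); exact: cvg_cst.
Unshelve. all: by end_near.
Qed.
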